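(* The quantity $\|\exp(tA_m)\|_2$ is bounded uniformly in $m\in\mathbb{Z}$ and $t>0$. Moreover, for every $m\in\mathbb{Z}\setminus\{0\}$ and $t>0$, $$\|\exp(tA_m)\|_2 \leq C^{(1)}\,(t^M+1)\,\exp(-\lambda^{(0)}t),$$ where $C^{(1)} = (M+1)\,(C^{(0)})^2$.
   Context: Let $M \geq 1$ be an integer, $D>0$ and $k = 2\pi/D$. The matrix $A$ is the real symmetric tridiagonal $(M+1)\times(M+1)$ matrix with zero diagonal whose off-diagonal entries are $A_{n,n+1}=A_{n+1,n}=\sqrt{n}$ for $n=1,\dots,M$ (rows and columns indexed from $1$ to $M+1$), all other entries being zero. The filter matrix $H = \mathrm{diag}\{h_0,h_1,\dots,h_M\}$ is a real diagonal $(M+1)\times(M+1)$ matrix with $h_i \leq 0$ for all $i$, $h_0 = 0$ and $h_M \neq 0$. For $m\in\mathbb{Z}$ put $A_m = -\mathrm{i}\, m k A + H$. $\|\cdot\|_2$ denotes the Euclidean norm of vectors and the induced spectral norm of matrices. The constants $C^{(0)}>0$ and $\lambda^{(0)}>0$, both independent of $m$, are as follows. For each $m\in\mathbb{Z}\setminus\{0\}$ write $A_m = R_mJ_mR_m^{-1}$ with $J_m$ the Jordan normal form of $A_m$ and every column of $R_m$ a unit vector; $C^{(0)}$ is such that $\|R_m\|_2\leq C^{(0)}$ and $\|R_m^{-1}\|_2\leq C^{(0)}$ for all $m\in\mathbb{Z}\setminus\{0\}$. The constant $\lambda^{(0)}$ is such that for every $m\in\mathbb{Z}\setminus\{0\}$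 all eigenvalues of $A_m$ have real parts less than $-\lambda^{(0)}$. *)

(* Defs.v *)
From mathcomp Require Export all_boot all_order all_algebra.
From mathcomp Require Export all_classical all_reals all_analysis.
From mathcomp Require Export complex.

Set Implicit Arguments.
Unset Strict Implicit.
Unset Printing Implicit Defensive.

Import Order.TTheory GRing.Theory Num.Theory.
Import numFieldNormedType.Exports.

Local Open Scope classical_set_scope.
Local Open Scope ring_scope.
Local Open Scope complex_scope.

Section Norms.
Variable R : realType.

Definition euclid n (x : 'cV[R[i]]_n) : R :=
  Num.sqrt (\sum_(j < n) ComplexField.Normc.normc (x j 0) ^+ 2).

(* For n > 0, where the unit sphere is nonempty. *)
Definition specnorm n (X : 'M[R[i]]_n) : R :=
  sup [set euclid (X *m x) | x in [set x : 'cV[R[i]]_n | euclid x = 1]].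

End Norms.

(* The limit is taken in the normed space of matrices over K; it is used below
   at K := R[i], whose topology is the one induced by the complex modulus. *)
Definition mexp (K : numFieldType) n (X : 'M[K]_n.+1) : 'M[K]_n.+1 :=
  limn (series (fun j : nat => (j`!%:R)^-1 *: X ^+ j)).

Section Jordan.
Variable K : fieldType.

Definition jordan_block (l : K) n : 'M[K]_n :=
  \matrix_(i, j) (l *+ (i == j) + (i.+1 == j)%:R).

(* The cast only identifies the sum of the block sizes with n. *)
Definition is_jordan n (J : 'M[K]_n) : Prop :=
  exists (q : nat) (p : 'I_q -> nat) (l : 'I_q -> K)
    (e : (\sum_(i < q) p i)%N = n),
    (forall i, (0 < p i)%N) /\
    J = castmx (e, e) (\mxdiag_(i < q) jordan_block (l i) (p i)).

Definition jordan_decomposition n (X P J : 'M[K]_n) : Prop :=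
  [/\ is_jordan J, P \in unitmx & X = P *m J *m invmx P].

End Jordan.

Section Model.
Variable R : realType.

(* Indices are shifted down by one: for 0-based i, the entries (i, i.+1) and
   (i.+1, i) are sqrt (i + 1). *)
Definition Amat (M : nat) : 'M[R]_M.+1 :=
  \matrix_(i, j) (if j == i.+1 :> nat then Num.sqrt i.+1%:R
                  else if i == j.+1 :> nat then Num.sqrt j.+1%:R
                  else 0).

Definition Hmat (M : nat) (h : 'I_M.+1 -> R) : 'M[R]_M.+1 :=
  diag_mx (\row_j h j).

Definition Am (M : nat) (D : R) (h : 'I_M.+1 -> R) (m : int) :
    'M[R[i]]_M.+1 :=
  (- ('i)%C * (m%:~R * (2 * pi / D))%:C) *: map_mx (real_complex R) (Amat M)
  + map_mx (real_complex R) (Hmat h).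

End Model.

(* Main.v *)
Require Import Defs.
From mathcomp Require Import ring lra.
Set Implicit Arguments.
Unset Strict Implicit.
Unset Printing Implicit Defensive.
Import Order.TTheory GRing.Theory Num.Theory.
Import numFieldNormedType.Exports.
Import ComplexField.Normc.
Local Open Scope classical_set_scope.
Local Open Scope ring_scope.
Local Open Scope complex_scope.

(* Both bounds are read off Euler's formula exp X = lim (1 + X / N)^N, which for
   matrices reduces to the scalar one by domination.
   Uniform bound: since A is real symmetric and H <= 0, Re <x, A_m x> <= 0, so
   |1 + t A_m / N| <= 1 + O(1 / N^2) and exp (t A_m) is a contraction.
   Decay: in A_m = P J P^-1 write J = L + S with L diagonal and S the 0/1
   superdiagonal, which commute. Then |S| <= 1, S^(M+1) = 0, and the strict
   inequality Re l < - lam gives |1 + t L / N| <= exp (- lam t / N) for large N,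
   so only the M + 1 terms k <= M of the binomial expansion of
   (1 + t L / N + t S / N)^N survive, each at most
   t^k exp (- lam t (N - k) / N). *)

(** * Euler's limit for real scalars, and its extension by domination *)

Lemma cvg_expR_harmonic (R : realType) (c d : R) :
  (fun n : nat => expR (c + d / n.+1%:R)) @ \oo --> expR c.
Proof.
apply: (cvg_comp (fun n : nat => c + d / n.+1%:R) expR).
  2: exact: continuous_expR.
suff : (fun n : nat => c + d / n.+1%:R) @ \oo --> c + d * 0 by rewrite mulr0 addr0.
apply: cvgD; first exact: cvg_cst.
by apply: cvgM; [exact: cvg_cst | exact: cvg_harmonic].
Qed.

(** Apply $1 + y \le e^y$ at $y = x^2 - x$ and use $(1 + x)(1 - x + x^2) = 1 + x^3 \ge 1$. This is
    the lower half of the squeeze for Euler's limit. *)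
Lemma expR_le1Dx (R : realType) (x : R) : 0 <= x -> expR (x - x ^+ 2) <= 1 + x.
Proof.
move=> x0; have e0 : 0 < expR (x - x ^+ 2) by rewrite expR_gt0.
have : 1 + (x ^+ 2 - x) <= expR (x ^+ 2 - x) by exact: expR_ge1Dx.
have -> : expR (x ^+ 2 - x) = (expR (x - x ^+ 2))^-1 by rewrite -expRN opprB.
rewrite -(ler_pM2l e0) divff ?gt_eqF// => H.
have : 0 <= x ^+ 3 by rewrite exprn_ge0.
have : 0 < 1 + (x ^+ 2 - x) by nra.
nra.
Qed.

Lemma cvg_exprD1_divn (R : realType) (a : R) : 0 <= a ->
  (fun n : nat => (1 + a / n.+1%:R) ^+ n.+1) @ \oo --> expR a.
Proof.
(* With $N = n + 1$ and $x = a / N$, the squeeze is the $N$-th power of $e^{x - x^2} \le 1 + x \le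
   e^x$. *)
move=> a0; apply: (@squeeze_cvgr _ _ _ _ (fun n => expR (a + - a ^+ 2 / n.+1%:R))
  (fun n => expR a)); last 2 first.
- exact: cvg_expR_harmonic.
- exact: cvg_cst.
apply: nearW => n; set x := a / n.+1%:R.
have n0 : n.+1%:R != 0 :> R by rewrite pnatr_eq0.
have x0 : 0 <= x by rewrite divr_ge0.
have -> : a + - a ^+ 2 / n.+1%:R = n.+1%:R * (x - x ^+ 2) by rewrite /x; field.
have {1}-> : a = n.+1%:R * x by rewrite /x mulrC divfK.
rewrite !expRM_natl !lerXn2r ?nnegrE ?expR_ge0 ?addr_ge0//.
  exact: expR_ge1Dx.
exact: expR_le1Dx.
Qed.

Lemma ffact_leq_exp (n k : nat) : (n ^_ k <= n ^ k)%N.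
Proof.
elim: k => [|k IH]; first by rewrite ffactn0 expn0.
by rewrite ffactnSr expnSr leq_mul ?leq_subr.
Qed.

(** The coefficient of $y^k$ in $(1 + y / n)^n$. *)
Definition euler_coeff (R : realType) (n k : nat) : R :=
  n%:R^-1 ^+ k *+ 'C(n, k).

(** $k!\,C(n, k)$ is a falling factorial, hence at most $n^k$. Thus the exponential series minus
    Euler's polynomial has nonnegative coefficients, which is what makes domination work. *)
Lemma euler_coeff_le (R : realType) (n k : nat) :
  euler_coeff R n.+1 k <= k`!%:R^-1.
Proof.
rewrite /euler_coeff -mulr_natr exprVn mulrC ler_pdivrMr ?exprn_gt0 ?ltr0n//.
rewrite -(ler_pM2r (_ : 0 < k`!%:R)) ?ltr0n ?fact_gt0// mulrAC mulVf ?mul1r.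
  by rewrite -natrM -natrX ler_nat bin_ffact ffact_leq_exp.
by rewrite pnatr_eq0 -lt0n fact_gt0.
Qed.

(* Termwise, [S_n(y) - E_n(y)] is dominated by [S_n(a) - E_n(a)] for the scalar
   sequence [a ^+ k], whose two limits are both [expR a]. *)
Lemma cvg_euler_sum (R : realType) (a : R) (y : nat -> R) :
    (forall k, `|y k| <= a ^+ k) ->
  let S := series (fun k => k`!%:R^-1 * y k) in
  S @ \oo --> limn S /\
  (fun n => \sum_(k < n.+2) euler_coeff R n.+1 k * y k) @ \oo --> limn S.
Proof.
move=> ya S; have a0 : 0 <= a by rewrite (le_trans _ (ya 1%N)) ?expr1.
have f0 k : 0 <= k`!%:R^-1 :> R by rewrite invr_ge0.
have cS : S @ \oo --> limn S.
  apply: normed_cvg; apply: (@series_le_cvg _ _ (exp_coeff a)) => [k|k|k|].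
  - exact: normr_ge0.
  - exact: exp_coeff_ge0.
  - by rewrite /exp_coeff /= normrM ger0_norm// mulrC ler_wpM2r.
  - exact: is_cvg_series_exp_coeff.
split => //.
(* This is the case $y_k = a^k$. The power $(1 + a / N)^N$ with $N = n + 1$ has $n + 2$ terms, hence
   the index [n.+2]. *)
have cE : (fun n => series (exp_coeff a) n.+2 - (1 + a / n.+1%:R) ^+ n.+1)
   @ \oo --> (0 : R).
  rewrite -(subrr (expR a)); apply: cvgB; last exact: cvg_exprD1_divn.
  have : series (exp_coeff a) @ \oo --> expR a by exact: is_cvg_series_exp_coeff.
  by rewrite -(cvg_shiftn 2); under eq_fun do rewrite /= addn2.
suff cD : (fun n => S n.+2 - \sum_(k < n.+2) euler_coeff R n.+1 k * y k)
     @ \oo --> (0 : R).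
  have cS2 : (fun n => S n.+2) @ \oo --> limn S.
    by move: cS; rewrite -(cvg_shiftn 2); under eq_fun do rewrite /= addn2.
  rewrite -[limn S]subr0.
  suff -> : (fun n => \sum_(k < n.+2) euler_coeff R n.+1 k * y k) =
    (fun n => S n.+2 - (S n.+2 - \sum_(k < n.+2) euler_coeff R n.+1 k * y k)).
    exact: cvgB.
  by apply/funext => n; rewrite subKr.
apply/norm_cvg0P; apply: (@squeeze_cvgr _ _ _ _ (fun=> 0)
  (fun n => series (exp_coeff a) n.+2 - (1 + a / n.+1%:R) ^+ n.+1));
  [|exact: cvg_cst|exact: cE].
apply: nearW => n /=; rewrite normr_ge0/=.
have -> : (1 + a / n.+1%:R) ^+ n.+1 = \sum_(k < n.+2) euler_coeff R n.+1 k * a ^+ k.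
  rewrite exprDn; apply: eq_bigr => k _.
  by rewrite expr1n mul1r exprMn /euler_coeff mulrnAl mulrC.
rewrite /S /series/= !big_mkord -!sumrB.
apply: (le_trans (ler_norm_sum _ _ _)); apply: ler_sum => k _.
rewrite /exp_coeff/= [a ^+ k / _]mulrC -!mulrBl normrM.
by rewrite ger0_norm ?ler_wpM2l// subr_ge0 euler_coeff_le.
Qed.

(** * Complex vectors as a real Euclidean space *)

Section Euclid.
Context {R : realType}.
Implicit Types z : R[i].

Lemma sqr_normc_ReIm z : normc z ^+ 2 = complex.Re z ^+ 2 + complex.Im z ^+ 2.
Proof. by case: z => a b /=; rewrite sqr_sqrtr// addr_ge0 ?sqr_ge0. Qed.

Lemma normc_ge0 z : 0 <= normc z.
Proof. by case: z => a b; exact: sqrtr_ge0. Qed.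

Lemma Re_mul z w : complex.Re (z * w) =
  complex.Re z * complex.Re w - complex.Im z * complex.Im w.
Proof. by case: z w => a b [c d]. Qed.

Lemma Im_mul z w : complex.Im (z * w) =
  complex.Re z * complex.Im w + complex.Im z * complex.Re w.
Proof. by case: z w => a b [c d]. Qed.

Lemma Re_sum I (r : seq I) (P : pred I) (F : I -> R[i]) :
  complex.Re (\sum_(i <- r | P i) F i) = \sum_(i <- r | P i) complex.Re (F i).
Proof. exact: raddf_sum. Qed.

Lemma Im_sum I (r : seq I) (P : pred I) (F : I -> R[i]) :
  complex.Im (\sum_(i <- r | P i) F i) = \sum_(i <- r | P i) complex.Im (F i).
Proof. exact: raddf_sum. Qed.

Lemma normr_Re_le z : `|complex.Re z| <= normc z.
Proof.
case: z => a b /=; rewrite -sqrtr_sqr ler_wsqrtr// lerDl sqr_ge0//.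
Qed.

Lemma normr_Im_le z : `|complex.Im z| <= normc z.
Proof.
case: z => a b /=; rewrite -sqrtr_sqr ler_wsqrtr// lerDr sqr_ge0//.
Qed.

Variable n : nat.
Implicit Types x y : 'cV[R[i]]_n.

Definition esq x : R := \sum_j (complex.Re (x j 0) ^+ 2 + complex.Im (x j 0) ^+ 2).
(** The real part of the Hermitian product, that is, the dot product of $\mathbb{R}^{2n}$. *)
Definition redot x y : R :=
  \sum_j (complex.Re (x j 0) * complex.Re (y j 0) +
           complex.Im (x j 0) * complex.Im (y j 0)).

Lemma euclidE x : euclid x = Num.sqrt (esq x).
Proof.
by rewrite /euclid; congr Num.sqrt; apply: eq_bigr => j _; rewrite sqr_normc_ReIm.
Qed.

Lemma esq_ge0 x : 0 <= esq x.
Proof. by apply: sumr_ge0 => j _; rewrite addr_ge0 ?sqr_ge0. Qed.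

Lemma euclid_ge0 x : 0 <= euclid x. Proof. exact: sqrtr_ge0. Qed.

Lemma sqr_euclid x : euclid x ^+ 2 = esq x.
Proof. by rewrite euclidE sqr_sqrtr ?esq_ge0. Qed.

Lemma esq0_eq0 x : esq x = 0 -> x = 0.
Proof.
move=> /psumr_eq0P => H; apply/colP => j; rewrite mxE.
have /eqP : complex.Re (x j 0) ^+ 2 + complex.Im (x j 0) ^+ 2 = 0.
  by apply: H => // k _; rewrite addr_ge0 ?sqr_ge0.
rewrite paddr_eq0 ?sqr_ge0// !sqrf_eq0.
by case: (x j 0) => a b /= /andP[/eqP-> /eqP->].
Qed.

Lemma esqDZ x y (c : R) :
  esq (x + c%:C *: y) = esq x + 2 * c * redot x y + c ^+ 2 * esq y.
Proof.
rewrite /esq /redot !mulr_sumr -!big_split/=; apply: eq_bigr => j _.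
rewrite !mxE; case: (x j 0) (y j 0) => a b [d e] /=; ring.
Qed.

(* The quadratic [c |-> esq (x + c y)] is nonnegative. *)
Lemma redot_le x y : redot x y <= euclid x * euclid y.
Proof.
have [y0|y0] := eqVneq (esq y) 0.
  have -> : y = 0 by exact: esq0_eq0.
  rewrite /redot big1 ?mulr_ge0 ?euclid_ge0// => j _.
  by rewrite mxE /= !mulr0 addr0.
have yp : 0 < esq y by rewrite lt_neqAle eq_sym y0 esq_ge0.
have [r0|r0] := leP (redot x y) 0.
  by rewrite (le_trans r0)// mulr_ge0 ?euclid_ge0.
rewrite -(ler_pXn2r (_ : 0 < 2)%N) ?nnegrE ?mulr_ge0 ?euclid_ge0 ?(ltW r0)//.
rewrite exprMn !sqr_euclid.
(* The scalar is the minimiser of the quadratic, where its value is $|x|^2 - (x \cdot y)^2 /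
   |y|^2$. *)
have := esq_ge0 (x + (- redot x y / esq y)%:C *: y).
rewrite esqDZ.
have -> : esq x + 2 * (- redot x y / esq y) * redot x y +
   (- redot x y / esq y) ^+ 2 * esq y = esq x - redot x y ^+ 2 / esq y by field.
by rewrite subr_ge0 ler_pdivrMr.
Qed.

Lemma euclidD x y : euclid (x + y) <= euclid x + euclid y.
Proof.
rewrite -(ler_pXn2r (_ : 0 < 2)%N) ?nnegrE ?addr_ge0 ?euclid_ge0//.
rewrite sqrrD !sqr_euclid.
have -> : x + y = x + (1 : R)%:C *: y by rewrite rmorph1 scale1r.
by rewrite esqDZ expr1n mul1r mulr1 lerD2r lerD2l -[leRHS]mulr_natl ler_wpM2l ?redot_le.
Qed.

Lemma euclid0 : euclid (0 : 'cV[R[i]]_n) = 0.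
Proof.
rewrite euclidE /esq big1 ?sqrtr0// => j _.
by rewrite mxE/= expr0n addr0.
Qed.

Lemma euclid_sum I (r : seq I) (P : pred I) (F : I -> 'cV[R[i]]_n) :
  euclid (\sum_(i <- r | P i) F i) <= \sum_(i <- r | P i) euclid (F i).
Proof.
elim/big_rec2 : _ => [|i b y _ H]; first by rewrite euclid0.
by apply: (le_trans (euclidD _ _)); rewrite lerD2l.
Qed.

Lemma euclidZ (c : R[i]) x : euclid (c *: x) = normc c * euclid x.
Proof.
rewrite /euclid -[normc c](ger0_norm (normc_ge0 c)) -sqrtr_sqr -sqrtrM ?sqr_ge0//.
congr Num.sqrt; rewrite mulr_sumr; apply: eq_bigr => j _.
by rewrite mxE normcM exprMn.
Qed.

Lemma normc_le_euclid x j : normc (x j 0) <= euclid x.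
Proof.
rewrite -[leLHS](ger0_norm (normc_ge0 _)) -sqrtr_sqr ler_wsqrtr//.
by rewrite (bigD1 j)//= lerDl sumr_ge0// => k _; rewrite sqr_ge0.
Qed.

Lemma euclid_delta j : euclid (delta_mx j 0 : 'cV[R[i]]_n) = 1.
Proof.
rewrite /euclid (bigD1 j)//= big1 => [|k kj].
  have -> : (delta_mx j 0 : 'cV[R[i]]_n) j 0 = 1 by rewrite mxE !eqxx.
  by rewrite normc1 expr1n addr0 sqrtr1.
have -> : (delta_mx j 0 : 'cV[R[i]]_n) k 0 = 0 by rewrite mxE (negbTE kj).
by rewrite normc0 expr0n.
Qed.

End Euclid.

(** * Operator bounds and the spectral norm *)

Section Opbound.
Context {R : realType}.

(** Stating bounds vector by vector avoids the supremum of [specnorm]: such bounds compose, add up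
    and pass to limits directly. *)
Definition opbound n (X : 'M[R[i]]_n) (b : R) :=
  forall x : 'cV[R[i]]_n, euclid (X *m x) <= b * euclid x.

Variable n : nat.
Implicit Types (X Y : 'M[R[i]]_n) (a b c : R).

Lemma opbound_le X a b : a <= b -> opbound X a -> opbound X b.
Proof. by move=> ab Xa x; rewrite (le_trans (Xa x))// ler_wpM2r ?euclid_ge0. Qed.

Lemma opboundM X Y a b : 0 <= a -> opbound X a -> opbound Y b ->
  opbound (X *m Y) (a * b).
Proof.
move=> a0 Xa Yb x; rewrite -mulmxA (le_trans (Xa _))// -mulrA ler_wpM2l//.
Qed.

Lemma opboundZ X a c : 0 <= c -> opbound X a -> opbound (c%:C *: X) (c * a).
Proof.
move=> c0 Xa x; rewrite -scalemxAl euclidZ -mulrA.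
by rewrite /= expr0n addr0 sqrtr_sqr ger0_norm// ler_wpM2l.
Qed.

Lemma opbound1 : opbound (1%:M : 'M[R[i]]_n) 1.
Proof. by move=> x; rewrite mul1mx mul1r. Qed.

Lemma opbound_sum I (r : seq I) (P : pred I) (F : I -> 'M[R[i]]_n) (b : I -> R) :
  (forall i, P i -> opbound (F i) (b i)) ->
  opbound (\sum_(i <- r | P i) F i) (\sum_(i <- r | P i) b i).
Proof.
move=> H x; rewrite mulmx_suml mulr_suml (le_trans (euclid_sum _ _ _))//.
by apply: ler_sum => i Pi; exact: H.
Qed.

Lemma opbound_normc X a i j : opbound X a -> normc (X i j) <= a.
Proof.
move=> /(_ (delta_mx j 0)); rewrite euclid_delta mulr1; apply: le_trans.
by rewrite -colE (le_trans _ (normc_le_euclid _ i))// mxE.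
Qed.

(** Expanding [X] in elementary matrices gives the crude bound by the sum of the moduli of the
    entries. Some finite bound is enough for dominating power series and for bounding the set under
    [sup]. *)
Lemma opbound_exists X : exists2 a, 0 <= a & opbound X a.
Proof.
exists (\sum_i \sum_j normc (X i j)).
  by apply: sumr_ge0 => i _; apply: sumr_ge0 => j _; exact: normc_ge0.
move=> x; rewrite [X in euclid (X *m _)]matrix_sum_delta.
rewrite mulmx_suml mulr_suml (le_trans (euclid_sum _ _ _))//.
apply: ler_sum => i _.
rewrite mulmx_suml mulr_suml (le_trans (euclid_sum _ _ _))//.
apply: ler_sum => j _.
rewrite -scalemxAl euclidZ ler_wpM2l ?normc_ge0//.
have -> : delta_mx i j *m x = x j 0 *: delta_mx i 0.
  apply/colP => k; rewrite !mxE (bigD1 j)//= big1 => [|l lj].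
    by rewrite !mxE !eqxx andbT addr0 mulrC.
  by rewrite mxE (negbTE lj) andbF mul0r.
by rewrite euclidZ euclid_delta mulr1 normc_le_euclid.
Qed.

End Opbound.

Section Specnorm.
Context {R : realType}.
Variable n : nat.
Implicit Types (X : 'M[R[i]]_n.+1) (b : R).

Lemma opboundX X b k : 0 <= b -> opbound X b -> opbound (X ^+ k) (b ^+ k).
Proof.
move=> b0 Xb; elim: k => [|k IH]; first exact: opbound1.
by rewrite !exprS; exact: opboundM.
Qed.

Lemma specnorm_le X b : opbound X b -> specnorm X <= b.
Proof.
move=> Xb; apply: ge_sup.
  exists (euclid (X *m delta_mx ord0 0)), (delta_mx ord0 0) => //=.
  exact: euclid_delta.
by move=> _ /= [x /= x1 <-]; rewrite (le_trans (Xb x))// x1 mulr1.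
Qed.

(** The supremum dominates its set because [opbound_exists] bounds that set; a vector of nonzero
    norm is then rescaled to the unit sphere. *)
Lemma opbound_specnorm X : opbound X (specnorm X).
Proof.
move=> x; have [a a0 Xa] := opbound_exists X.
have [x0|x0] := eqVneq (euclid x) 0.
  by rewrite (le_trans (Xa x))// x0 !mulr0.
have xp : 0 < euclid x by rewrite lt_neqAle eq_sym x0 euclid_ge0.
have nx : normc ((euclid x)^-1%:C) = (euclid x)^-1.
  by rewrite /= expr0n addr0 sqrtr_sqr ger0_norm// invr_ge0 ltW.
rewrite -ler_pdivrMr// mulrC -nx -euclidZ scalemxAr.
apply: ub_le_sup.
  by exists a => _ /= [y /= y1 <-]; rewrite (le_trans (Xa y))// y1 mulr1.
by exists ((euclid x)^-1%:C *: x) => //=; rewrite euclidZ nx mulVf.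
Qed.

End Specnorm.

(** * The matrix exponential as the limit of Euler's products *)

Lemma cvg_mx_entries (T : puniformType) m n (u : nat -> 'M[T]_(m, n))
    (L : 'M[T]_(m, n)) :
  (forall i j, (fun k => u k i j) @ \oo --> L i j) -> u @ \oo --> L.
Proof.
move=> uL; apply/cvg_mx_entourageP => A entA.
apply: filter_forall => i; apply: filter_forall => j.
by have /cvg_app_entourageP/(_ _ entA) := uL i j; apply: filterS => k Ak; apply/mem_set.
Qed.

Lemma cvg_complex (R : realType) (z : nat -> (R[i] : numFieldType))
    (l : (R[i] : numFieldType)) :
  (fun k => complex.Re (z k)) @ \oo --> complex.Re l ->
  (fun k => complex.Im (z k)) @ \oo --> complex.Im l ->
  z @ \oo --> l.
Proof.
move=> /cvgrPdist_lt cRe /cvgrPdist_lt cIm.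
(* Positivity in the order of [R[i]] forces the imaginary part of the radius to be zero, so the
   radius is a positive real. *)
apply/cvgrPdist_lt => -[e e']; rewrite ltcE/= => /andP[/eqP -> e0].
have e2 : 0 < e / 2 by rewrite divr_gt0.
near=> k.
rewrite normc_def ltcR.
have hr : `|complex.Re l - complex.Re (z k)| < e / 2 by near: k; exact: cRe.
have hi : `|complex.Im l - complex.Im (z k)| < e / 2 by near: k; exact: cIm.
rewrite -(ger0_norm (ltW e0)) -[ltRHS]sqrtr_sqr ltr_sqrt ?exprn_gt0//.
move: hr hi; rewrite !raddfB/= !ltr_norml => /andP[? ?] /andP[? ?].
by nra.
Unshelve. all: by end_near. Qed.

Section Mexp.
Context {R : realType} {n : nat}.
Variable X : 'M[R[i]]_n.+1.

(** Euler's product with $N = k + 1$; the shift keeps the divisor nonzero. *)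
Definition euler (k : nat) : 'M[R[i]]_n.+1 :=
  (1 + (k.+1%:R^-1 : R)%:C *: X) ^+ k.+1.

Lemma eulerE k :
  euler k = \sum_(l < k.+2) (euler_coeff R k.+1 l)%:C *: X ^+ l.
Proof.
rewrite /euler exprDn_comm; last exact: commr_sym (commr1 _).
apply: eq_bigr => l _; rewrite expr1n mul1r exprZn /euler_coeff.
by rewrite rmorphMn rmorphXn scalerMnl.
Qed.

Lemma Re_scale (c : R) (z : R[i]) : complex.Re (c%:C * z) = c * complex.Re z.
Proof. by case: z => a b /=; rewrite mul0r subr0. Qed.

Lemma Im_scale (c : R) (z : R[i]) : complex.Im (c%:C * z) = c * complex.Im z.
Proof. by case: z => a b /=; rewrite mul0r addr0. Qed.

Lemma mexp_seriesE k : series (fun j : nat => (j`!%:R)^-1 *: X ^+ j) k =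
  \sum_(0 <= j < k) ((j`!%:R)^-1 : R)%:C *: X ^+ j.
Proof. by apply: eq_bigr => j _; rewrite fmorphV rmorph_nat. Qed.

(** If [a] bounds [X], the real and imaginary parts of the entries of [X ^+ k] are at most $a^k$ in
    absolute value. So [cvg_euler_sum] gives the exponential series and Euler's products the same
    limit, entry by entry. *)
Lemma cvg_euler i j :
  (fun k => complex.Re (euler k i j)) @ \oo --> complex.Re (mexp X i j) /\
  (fun k => complex.Im (euler k i j)) @ \oo --> complex.Im (mexp X i j).
Proof.
have [a a0 Xa] := opbound_exists X.
have bRe i' j' k : `|complex.Re ((X ^+ k) i' j')| <= a ^+ k.
  by rewrite (le_trans (normr_Re_le _))//; apply: opbound_normc; exact: opboundX.
have bIm i' j' k : `|complex.Im ((X ^+ k) i' j')| <= a ^+ k.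
  by rewrite (le_trans (normr_Im_le _))//; apply: opbound_normc; exact: opboundX.
pose lR i' j' := limn (series (fun k => k`!%:R^-1 * complex.Re ((X ^+ k) i' j'))).
pose lI i' j' := limn (series (fun k => k`!%:R^-1 * complex.Im ((X ^+ k) i' j'))).
have mexpE : mexp X = \matrix_(i', j') (lR i' j' +i* lI i' j').
  apply: cvg_lim => //; apply: cvg_mx_entries => i' j'; rewrite mxE.
  apply: cvg_complex => /=.
    have [cR _] := cvg_euler_sum (bRe i' j').
    move: cR; rewrite -/(lR _ _); set f := series _; set g := (fun k => _).
    suff -> : g = f by [].
    apply/funext => k; rewrite /g mexp_seriesE summxE Re_sum /f /series/=.
    by apply: eq_bigr => l _; rewrite mxE Re_scale.
  have [cI _] := cvg_euler_sum (bIm i' j').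
  move: cI; rewrite -/(lI _ _); set f := series _; set g := (fun k => _).
  suff -> : g = f by [].
  apply/funext => k; rewrite /g mexp_seriesE summxE Im_sum /f /series/=.
  by apply: eq_bigr => l _; rewrite mxE Im_scale.
rewrite mexpE mxE/=; split.
  have [_] := cvg_euler_sum (bRe i j); rewrite -/(lR _ _).
  set f := (fun k => _); set g := (fun k => _).
  suff -> : g = f by [].
  apply/funext => k; rewrite /g eulerE summxE Re_sum.
  by apply: eq_bigr => l _; rewrite mxE Re_scale.
have [_] := cvg_euler_sum (bIm i j); rewrite -/(lI _ _).
set f := (fun k => _); set g := (fun k => _).
suff -> : g = f by [].
apply/funext => k; rewrite /g eulerE summxE Im_sum.
by apply: eq_bigr => l _; rewrite mxE Im_scale.
Qed.

Lemma cvg_euler_mul (x : 'cV[R[i]]_n.+1) i :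
  (fun k => complex.Re ((euler k *m x) i 0)) @ \oo --> complex.Re ((mexp X *m x) i 0) /\
  (fun k => complex.Im ((euler k *m x) i 0)) @ \oo --> complex.Im ((mexp X *m x) i 0).
Proof.
split; rewrite mxE ?Re_sum ?Im_sum; under eq_fun do rewrite mxE ?Re_sum ?Im_sum;
  apply: cvg_big; (try exact: add_continuous) => l _; rewrite ?Re_mul ?Im_mul;
  under eq_fun do rewrite ?Re_mul ?Im_mul; have [cR cI] := cvg_euler i l.
- by apply: cvgB; (apply: cvgM; [|exact: cvg_cst]).
- by apply: cvgD; (apply: cvgM; [|exact: cvg_cst]).
Qed.

Lemma cvg_euclid_euler (x : 'cV[R[i]]_n.+1) :
  (fun k => euclid (euler k *m x)) @ \oo --> euclid (mexp X *m x).
Proof.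
rewrite euclidE; under eq_fun do rewrite euclidE.
apply: (cvg_comp (fun k => esq (euler k *m x)) Num.sqrt);
  last exact: sqrt_continuous.
apply: cvg_big; first exact: add_continuous.
move=> i _; have [cR cI] := cvg_euler_mul x i.
by apply: cvgD; under eq_fun do rewrite expr2; rewrite expr2; exact: cvgM.
Qed.

(** The norm is continuous, so eventual bounds on Euler's products pass to the exponential. Both
    estimates of the theorem go through this lemma. *)
Lemma opbound_mexp (b : nat -> R) (B : R) : b @ \oo --> B ->
  (\forall k \near \oo, opbound (euler k) (b k)) -> opbound (mexp X) B.
Proof.
move=> bB eb x.
have cb : (fun k => b k * euclid x) @ \oo --> B * euclid x.
  by apply: cvgM => //; exact: cvg_cst.
apply: (ler_cvg_to (@cvg_euclid_euler x) cb).
by apply: filterS eb => k; exact.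
Qed.

End Mexp.

(** * The uniform bound: dissipative matrices generate contractions *)

Lemma opbound_mexp_dissipative (R : realType) n (X : 'M[R[i]]_n.+1) :
  (forall x, redot x (X *m x) <= 0) -> opbound (mexp X) 1.
Proof.
move=> dissX; have [a a0 Xa] := opbound_exists X.
rewrite -(@expR0 R).
(* With $e = 1 / N$, dissipativity removes the cross term: $|x + e X x|^2 \le (1 + e^2 a^2) |x|^2
   \le e^{a^2 / N^2} |x|^2$. Taking the square root and then the $N$-th power leaves $e^{a^2 /
   (2N)}$, which tends to 1. *)
apply: (@opbound_mexp _ _ _ (fun k => expR (0 + a ^+ 2 / 2 / k.+1%:R))).
  exact: cvg_expR_harmonic.
apply: nearW => k; rewrite add0r; set e := k.+1%:R^-1 : R.
have e0 : 0 <= e by rewrite invr_ge0.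
have -> : expR (a ^+ 2 / 2 * e) = expR (e ^+ 2 * a ^+ 2 / 2) ^+ k.+1.
  by rewrite -expRM_natl; congr expR; rewrite /e; field; rewrite addrC natr1 pnatr_eq0.
apply: opboundX; first exact: expR_ge0.
move=> x; rewrite mulmxDl mul1mx -scalemxAl.
rewrite -(ler_pXn2r (_ : 0 < 2)%N) ?nnegrE ?mulr_ge0 ?expR_ge0 ?euclid_ge0//.
rewrite sqr_euclid esqDZ exprMn.
have -> : expR (e ^+ 2 * a ^+ 2 / 2) ^+ 2 = expR (e ^+ 2 * a ^+ 2).
  by rewrite -expRM_natl mulrC divfK ?pnatr_eq0.
have h1 : 1 + e ^+ 2 * a ^+ 2 <= expR (e ^+ 2 * a ^+ 2) by exact: expR_ge1Dx.
have h2 : esq (X *m x) <= a ^+ 2 * esq x.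
  by rewrite -!sqr_euclid -exprMn lerXn2r ?nnegrE ?mulr_ge0 ?euclid_ge0.
have h3 : 0 <= - (e * redot x (X *m x)) by rewrite oppr_ge0 mulr_ge0_le0.
have h4 : e ^+ 2 * esq (X *m x) <= e ^+ 2 * (a ^+ 2 * esq x).
  by rewrite ler_wpM2l ?sqr_ge0.
have h5 : (1 + e ^+ 2 * a ^+ 2) * esq x <= expR (e ^+ 2 * a ^+ 2) * esq x.
  by rewrite ler_wpM2r ?esq_ge0.
by rewrite sqr_euclid -/e; nra.
Qed.

Lemma redot_Am_le0 (R : realType) M (D : R) h (m : int) (x : 'cV[R[i]]_M.+1) :
  (forall i, h i <= 0) -> redot x (Am D h m *m x) <= 0.
Proof.
move=> h0; set s : R := m%:~R * (2 * pi / D).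
pose c j := complex.Re (x j 0); pose d j := complex.Im (x j 0).
(* Since $A$ is real, $-\mathrm{i} s A$ contributes an antisymmetric form in the real and imaginary
   parts [c], [d], and $H$ contributes $\sum_j h_j |x_j|^2$. *)
have -> : redot x (Am D h m *m x) =
    \sum_j \sum_k s * Amat R M j k * (c j * d k - d j * c k)
    + \sum_j h j * (c j ^+ 2 + d j ^+ 2).
  rewrite -big_split; apply: eq_bigr => j _ /=.
  have -> : h j * (c j ^+ 2 + d j ^+ 2) =
      \sum_k Hmat h j k * (c j * c k + d j * d k).
    rewrite (bigD1 j)//= big1 => [|k kj]; first by rewrite !mxE eqxx/= addr0 !expr2.
    by rewrite !mxE eq_sym (negbTE kj) mul0r.
  rewrite mxE Re_sum Im_sum !mulr_sumr -!big_split/=; apply: eq_bigr => k _.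
  have -> : Am D h m j k =
      (- 'i)%C * s%:C * (Amat R M j k)%:C + (Hmat h j k)%:C by rewrite !mxE.
  rewrite /c /d; move: (Amat _ _ _ _) (Hmat _ _ _) (x j 0) (x k 0).
  by move=> A H [a b] [e f] /=; ring.
set S := (X in X + _ <= _).
have S0 : S = 0.
  (* Exchanging the two summation indices negates [S], because $A$ is symmetric. *)
  suff : S = - S by move=> /eqP; rewrite -addr_eq0 -mulr2n mulrn_eq0/= => /eqP.
  rewrite {1}/S exchange_big -sumrN; apply: eq_bigr => j _ /=.
  rewrite -sumrN; apply: eq_bigr => k _.
  have -> : Amat R M k j = Amat R M j k.
    (* Only $k = j + 1$ together with $j = k + 1$ could separate the two entries, and this is
       impossible. *)
    rewrite !mxE; case: eqP => [kj|_]; case: eqP => [jk|_] //.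
    by have := ltnn j; rewrite {2}kj jk ltnW.
  by ring.
rewrite S0 add0r -oppr_ge0 -sumrN; apply: sumr_ge0 => j _.
by rewrite oppr_ge0 mulr_le0_ge0// addr_ge0 ?sqr_ge0.
Qed.

Lemma redotZ (R : realType) n (x y : 'cV[R[i]]_n) (c : R) :
  redot x (c%:C *: y) = c * redot x y.
Proof.
rewrite /redot mulr_sumr; apply: eq_bigr => j _.
by rewrite !mxE; case: (x j 0) (y j 0) => a b [e f] /=; ring.
Qed.

(** * Algebra of Jordan matrices *)

Section JordanStructure.
Variable K : fieldType.

(** The relation [s] marks the superdiagonal positions inside a single block; after this flat
    encoding the dependent block sizes are no longer needed. *)
Definition shift_part n (s : rel 'I_n) : 'M[K]_n :=
  \matrix_(i, j) ((i.+1 == j) && s i j)%:R.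

Lemma is_jordan_split n (J : 'M[K]_n) : is_jordan J ->
  exists (d : 'rV[K]_n) (s : rel 'I_n),
    (forall i j, s i j -> d 0 i = d 0 j) /\ J = diag_mx d + shift_part s.
Proof.
move=> [q [p [l [e [_ ->]]]]] {J}; case: n / e; rewrite castmx_id.
exists (\row_i l (tagnat.sig1 i)), (fun i j => tagnat.sig1 i == tagnat.sig1 j).
split=> [i j /= /eqP ij|]; first by rewrite !mxE ij.
apply/matrixP => i j; rewrite -(tagnat.sig2K i) -(tagnat.sig2K j).
move: (tagnat.sig1 i) (tagnat.sig2 i) (tagnat.sig1 j) (tagnat.sig2 j) => a u b v.
(* The sizes [p a] and [p b] agree only when [a = b], so the diagonal block is cast by
   [conform_mx]. *)
pose B a b : 'M[K]_(p a, p b) :=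
  if a == b then conform_mx 0 (jordan_block (l a) (p a)) else 0.
have -> : (\mxdiag_k jordan_block (l k) (p k))
    (tagnat.Rank a u) (tagnat.Rank b v) = B a b u v.
  have := congr1 (fun Z : 'M[K]_(p a, p b) => Z u v) (mxblockK B a b).
  by rewrite mxE.
rewrite /B.
rewrite !mxE !tagnat.Rank1K.
have [ab|ab] := eqVneq a b; last first.
  rewrite mxE andbF addr0 [_ == _](_ : _ = false) ?mulr0n//.
  by apply/negbTE; apply: contra ab => /eqP/(congr1 (@tagnat.sig1 _ _));
    rewrite !tagnat.Rank1K => ->.
case: b / ab v => v; rewrite conform_mx_id !mxE andbT.
rewrite -[tagnat.Rank a u == _]/(nat_of_ord _ == nat_of_ord _).
(* Within one block both global indices carry the same offset, which cancels in the superdiagonal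
   condition. *)
by rewrite !tagnat.RankEsum -addnS !eqn_add2l.
Qed.

Lemma comm_diag_shift n (d : 'rV[K]_n) (s : rel 'I_n) :
  (forall i j, s i j -> d 0 i = d 0 j) ->
  diag_mx d *m shift_part s = shift_part s *m diag_mx d.
Proof.
move=> ds; apply/matrixP => i j; rewrite mul_diag_mx mul_mx_diag !mxE.
by have [/andP[_ /ds->]|_] := boolP (_ && _); rewrite ?mulr1 ?mul1r ?mulr0 ?mul0r.
Qed.

(** The [k]-th power is supported on the [k]-th superdiagonal, which is empty for [k > n] in size
    [n.+1]. *)
Lemma shift_part_expr_eq0 n (s : rel 'I_n.+1) k :
  (n < k)%N -> shift_part s ^+ k = 0.
Proof.
have H : forall k (i j : 'I_n.+1), (i + k != j)%N -> (shift_part s ^+ k) i j = 0.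
  elim=> [|k' IH] i j; first by rewrite addn0 expr0 mxE val_eqE => /negbTE->.
  move=> ij; rewrite exprS mxE big1// => l _.
  rewrite mxE; have [/= il|] := eqVneq i.+1 l; last by rewrite mul0r.
  by rewrite IH ?mulr0// -il addSnnS.
move=> nk; apply/matrixP => i j; rewrite H ?mxE// gtn_eqF//.
by rewrite (leq_trans (ltn_ord j))// (leq_trans nk)// leq_addl.
Qed.

(** Subtracting the scalar [d 0 i] leaves a triangular matrix with a zero on its diagonal, hence a
    singular one. The transpose is taken because [det_trig] is about lower triangular matrices. *)
Lemma eigenvalue_jordan_diag n (d : 'rV[K]_n) (s : rel 'I_n) i :
  eigenvalue (diag_mx d + shift_part s) (d 0 i).
Proof.
rewrite /eigenvalue /eigenspace kermx_eq0 row_free_unit unitmxE unitfE negbK.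
rewrite -det_tr det_trig.
  by rewrite (bigD1 i)//= !mxE eqxx (gtn_eqF (ltnSn i)) /= addr0 subrr mul0r.
apply/is_trig_mxP => k j kj; rewrite !mxE.
have -> : (j == k) = false by apply/negbTE; rewrite -val_eqE gtn_eqF.
have -> : (j.+1 == k) = false by rewrite gtn_eqF// ltnS ltnW.
by rewrite /= !mulr0n addr0 subr0.
Qed.

(** Eigenvectors are row vectors here, so they are transported by [invmx P] on the right. *)
Lemma eigenvalue_similar n (P J : 'M[K]_n) z : P \in unitmx ->
  eigenvalue J z -> eigenvalue (P *m J *m invmx P) z.
Proof.
move=> uP /eigenvalueP[v vJ v0]; apply/eigenvalueP; exists (v *m invmx P).
  by rewrite !mulmxA mulmxKV// vJ scalemxAl.
by apply: contra v0 => /eqP H; rewrite -(mulmxKV uP v) H mul0mx.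
Qed.

Lemma conj_expr n (P Y : 'M[K]_n.+1) k : P \in unitmx ->
  (P *m Y *m invmx P) ^+ k = P *m Y ^+ k *m invmx P.
Proof.
move=> uP; elim: k => [|k IH]; first by rewrite !expr0 mulmx1 mulmxV.
by rewrite !exprS IH -!mulmxE !mulmxA mulmxKV.
Qed.

End JordanStructure.

(** * Norm estimates for Jordan matrices and the decay bound *)

Section JordanBounds.
Context {R : realType}.

Lemma opbound_diag n (d : 'rV[R[i]]_n) g : 0 <= g ->
  (forall i, normc (d 0 i) <= g) -> opbound (diag_mx d) g.
Proof.
move=> g0 dg x.
rewrite -(ler_pXn2r (_ : 0 < 2)%N) ?nnegrE ?mulr_ge0 ?euclid_ge0//.
rewrite exprMn /euclid !sqr_sqrtr ?sumr_ge0// => [|? _|? _]; rewrite ?sqr_ge0//.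
rewrite mulr_sumr ler_sum// => j _.
rewrite mul_diag_mx mxE normcM exprMn ler_wpM2r ?sqr_ge0//.
by rewrite lerXn2r ?nnegrE ?normc_ge0.
Qed.

Lemma opbound_shift_part n (s : rel 'I_n) : opbound (shift_part R[i] s) 1.
Proof.
move=> x; rewrite mul1r.
rewrite /euclid; apply: ler_wsqrtr.
(* Row [i] of the shift has at most the entry at [j = i + 1], and the last row is zero. Summing over
   [i] first then counts each coordinate of [x] at most once. *)
apply: (@le_trans _ _ (\sum_(i < n) \sum_(j < n) (i.+1 == j)%:R * normc (x j 0) ^+ 2)).
  apply: ler_sum => i _; rewrite mxE.
  have [ni|ni] := ltnP i.+1 n; last first.
    rewrite big1 ?normc0 ?expr0n ?sumr_ge0// => [? _|j _].
      by rewrite mulr_ge0// sqr_ge0.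
    by rewrite mxE gtn_eqF ?mul0r// (leq_trans (ltn_ord j)).
  rewrite (bigD1 (Ordinal ni))//= [X in _ <= X](bigD1 (Ordinal ni))//= eqxx mul1r.
  rewrite !big1 ?addr0 => [|j|j].
  - rewrite mxE /= eqxx /=; case: (s _ _); first by rewrite mul1r.
    by rewrite mul0r normc0 expr0n sqr_ge0.
  - by rewrite -val_eqE /= eq_sym => /negbTE->; rewrite mul0r.
  - by rewrite mxE -val_eqE /= eq_sym => /negbTE->; rewrite mul0r.
rewrite exchange_big /=; apply: ler_sum => j _; rewrite -mulr_suml.
rewrite ler_piMl ?sqr_ge0// -natr_sum lern1 -big_mkcond/= sum1_card.
apply/card_le1_eqP => a b; rewrite !unfold_in => /eqP ja /eqP jb.
by apply/val_inj/succn_inj; rewrite ja jb.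
Qed.

End JordanBounds.

Lemma opboundMn (R : realType) n (X : 'M[R[i]]_n) b m :
  opbound X b -> opbound (X *+ m) (b *+ m).
Proof.
move=> Xb; rewrite -scaler_nat -(rmorph_nat (real_complex R)) -[b *+ m]mulr_natl.
exact: opboundZ.
Qed.

Lemma expr_le_expr_max1 (R : realType) (t : R) (k M : nat) : 0 <= t -> (k <= M)%N ->
  t ^+ k <= t ^+ M + 1.
Proof.
move=> t0 kM; have [t1|t1] := leP t 1.
  by rewrite (@le_trans _ _ 1) ?exprn_ile1// lerDr exprn_ge0.
by rewrite (@le_trans _ _ (t ^+ M)) ?lerDl// ler_weXn2l ?ltW.
Qed.

(** The factor $C(N, l) / N^l \le 1 / l! \le 1$ leaves $t^l \le t^M + 1$, and the exponent $-\lambda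
    t (N - l) / N$ grows when $l$ is replaced by $M$. The bound is thus the same for all surviving
    terms. *)
Lemma binomial_term_le (R : realType) (t lam : R) (l M k : nat) :
  0 < t -> 0 < lam -> (l <= M)%N -> (l <= k)%N ->
  expR (- lam * (t / k.+1%:R)) ^+ (k.+1 - l) * (t / k.+1%:R) ^+ l *+ 'C(k.+1, l)
    <= (t ^+ M + 1) * expR (- lam * t + lam * t * M%:R / k.+1%:R).
Proof.
move=> t0 lam0 lM lk; have tl : 0 <= t ^+ l by apply: exprn_ge0; exact: ltW.
rewrite -mulrnAr mulrC; apply: ler_pM.
- by apply: mulrn_wge0; apply: exprn_ge0; rewrite divr_ge0// ltW.
- by apply: exprn_ge0; exact: expR_ge0.
- apply: (@le_trans _ _ (t ^+ l)); last by apply: expr_le_expr_max1 => //; exact: ltW.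
  rewrite exprMn -mulrnAr; apply: ler_piMr => //.
  apply: (le_trans (euler_coeff_le _ _ _)).
  by rewrite invf_le1 ?ler1n ?ltr0n fact_gt0.
- rewrite -expRM_natl ler_expR natrB ?leqW//.
  have -> : (k.+1%:R - l%:R) * (- lam * (t / k.+1%:R)) =
    - lam * t + lam * t * l%:R / k.+1%:R :> R by field; rewrite addrC natr1 pnatr_eq0.
  rewrite lerD2l; apply: ler_wpM2r; first by rewrite invr_ge0.
  by apply: ler_wpM2l; [rewrite mulr_ge0// ltW | rewrite ler_nat].
Qed.

Section JordanEuler.
Context {R : realType} (M : nat).
Variables (d : 'rV[R[i]]_M.+1) (s : rel 'I_M.+1).
Hypothesis ds : forall i j, s i j -> d 0 i = d 0 j.
Variables (t lam : R) (t0 : 0 < t) (lam0 : 0 < lam).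
Hypothesis dlam : forall i, complex.Re (d 0 i) < - lam.
Let J := diag_mx d + shift_part _ s.

(* [|1 + u z|^2 = 1 + 2 u Re z + u^2 |z|^2], and the quadratic term is absorbed
   for small [u] because [Re z] is strictly less than [- lam]. *)
Lemma normc_euler_factor (z : R[i]) (u : R) : 0 <= u ->
  complex.Re z < - lam ->
  u * normc z ^+ 2 <= 2 * (- lam - complex.Re z) ->
  normc (1 + u%:C * z) <= expR (- lam * u).
Proof.
move=> u0 zlam uz; rewrite -(ler_pXn2r (_ : 0 < 2)%N) ?nnegrE ?expR_ge0 ?normc_ge0//.
rewrite -expRM_natl; apply: le_trans (expR_ge1Dx _).
move: uz; rewrite !sqr_normc_ReIm; case: z zlam => a b /= zlam uz.
have := ler_wpM2l u0 uz; nra.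
Qed.

Lemma opbound_jordan_factor :
  \forall k \near \oo, opbound (1 + diag_mx ((t / k.+1%:R)%:C *: d))
    (expR (- lam * (t / k.+1%:R))).
Proof.
(* There are finitely many diagonal entries, each with a positive gap below [- lam], so one
   threshold on [k] serves them all. *)
have : \forall k \near \oo, forall i, (t / k.+1%:R) * normc (d 0 i) ^+ 2
    <= 2 * (- lam - complex.Re (d 0 i)).
  apply: filter_forall => i.
  have p : 0 < 2 * (- lam - complex.Re (d 0 i)) by rewrite mulr_gt0 ?subr_gt0.
  near=> k.
  rewrite mulrAC ler_pdivrMr// mulrC [leRHS]mulrC -ler_pdivrMr//.
  rewrite (@le_trans _ _ k%:R) ?ler_nat//.
  by near: k; exact: nbhs_infty_ger.
apply: filterS => k Hk.
have -> : 1 + diag_mx ((t / k.+1%:R)%:C *: d) =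
    diag_mx (\row_i (1 + (t / k.+1%:R)%:C * d 0 i)).
  apply/matrixP => i j; rewrite !mxE; case: eqP => [->|_]; rewrite ?mulr1n//.
  by rewrite !mulr0n addr0.
apply: opbound_diag => [|i]; first exact: expR_ge0.
rewrite mxE; apply: normc_euler_factor => //.
by rewrite divr_ge0// ltW.
Unshelve. all: by end_near. Qed.

Lemma euler_jordanE k : euler (t%:C *: J) k =
  (1 + diag_mx ((t / k.+1%:R)%:C *: d)
     + (t / k.+1%:R)%:C *: shift_part _ s) ^+ k.+1.
Proof.
rewrite /euler scalerA -rmorphM/= mulrC /J scalerDr addrA.
congr ((1 + _ + _) ^+ _); apply/matrixP => i j; rewrite !mxE.
by rewrite mulrnAr.
Qed.

Lemma comm_jordan_factor (c : R[i]) :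
  GRing.comm (1 + diag_mx (c *: d)) (c *: shift_part _ s).
Proof.
apply: commr_sym; apply: commrD; first exact: commr1.
rewrite /GRing.comm -!mulmxE -scalemxAl -(@comm_diag_shift _ _ (c *: d)).
  exact: scalemxAr.
by move=> i j /ds ij; rewrite !mxE ij.
Qed.

Lemma opbound_jordan_euler :
  \forall k \near \oo, opbound (euler (t%:C *: J) k)
    (M.+1%:R * ((t ^+ M + 1) * expR (- lam * t + lam * t * M%:R / k.+1%:R))).
Proof.
near=> k.
have kM : (M <= k)%N by near: k; exact: nbhs_infty_ge.
have G : opbound (1 + diag_mx ((t / k.+1%:R)%:C *: d))
    (expR (- lam * (t / k.+1%:R))).
  by near: k; exact: opbound_jordan_factor.
have u0 : 0 <= t / k.+1%:R by rewrite divr_ge0// ltW.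
rewrite euler_jordanE (exprDn_comm _ (comm_jordan_factor _)).
have kM2 : (M.+1 <= k.+2)%N by rewrite ltnS leqW.
(* Nilpotency of the shift kills the terms with [l > M]. *)
rewrite (bigID (fun l : 'I_k.+2 => (l < M.+1)%N))/=.
rewrite [X in _ + X]big1 ?addr0; last first.
  move=> l; rewrite -leqNgt => Ml.
  by rewrite exprZn shift_part_expr_eq0 ?scaler0 ?mulr0 ?mul0rn.
rewrite (big_ord_narrow kM2)/= -[M.+1 in X in opbound _ X]card_ord mulr_natl.
rewrite -sumr_const; apply: opbound_sum => l _ /=.
have lM : (l <= M)%N by rewrite -ltnS.
apply: opbound_le (binomial_term_le t0 lam0 lM (leq_trans lM kM)) _.
apply: opboundMn; apply: opboundM; first by rewrite exprn_ge0// expR_ge0.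
  by apply: opboundX; [exact: expR_ge0 | exact: G].
apply: opboundX; first exact: u0.
rewrite -[X in opbound _ X]mulr1.
by apply: opboundZ; [exact: u0 | exact: opbound_shift_part].
Unshelve. all: by end_near. Qed.

End JordanEuler.

Lemma euler_conj (R : realType) n (P Y : 'M[R[i]]_n.+1) k : P \in unitmx ->
  euler (P *m Y *m invmx P) k = P *m euler Y k *m invmx P.
Proof.
move=> uP; rewrite /euler; apply: etrans (conj_expr _ _ uP); congr (_ ^+ _).
by rewrite mulmxDr mulmxDl mulmx1 mulmxV// -scalemxAr -scalemxAl.
Qed.

(** Euler's products commute with conjugation, so [P] and its inverse cost a factor [C] each before
    the limit. The excess $\lambda t M / N$ in the exponent disappears in the limit. *)
Lemma opbound_mexp_jordan (R : realType) M (X P J : 'M[R[i]]_M.+1) (C lam t : R) :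
  jordan_decomposition X P J -> 0 < lam -> 0 < t ->
  specnorm P <= C -> specnorm (invmx P) <= C ->
  (forall z, eigenvalue X z -> complex.Re z < - lam) ->
  opbound (mexp (t%:C *: X))
    (M.+1%:R * C ^+ 2 * (t ^+ M + 1) * expR (- lam * t)).
Proof.
move=> [/is_jordan_split[d [s [ds ->]]] uP ->] lam0 t0 PC QC eig.
(* Nonnegativity of [C] follows by testing the bound on a unit vector. *)
have C0 : 0 <= C.
  apply: le_trans PC; have := @opbound_specnorm _ _ P (delta_mx 0 0).
  by rewrite euclid_delta mulr1; apply: le_trans; exact: euclid_ge0.
have dlam i : complex.Re (d 0 i) < - lam.
  by apply: eig; apply: eigenvalue_similar => //; exact: eigenvalue_jordan_diag.
rewrite scalemxAl scalemxAr.
apply: (@opbound_mexp _ _ _ (fun k => M.+1%:R * C ^+ 2 * (t ^+ M + 1) *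
    expR (- lam * t + lam * t * M%:R / k.+1%:R))).
  by apply: cvgM; [exact: cvg_cst | exact: cvg_expR_harmonic].
apply: filterS (opbound_jordan_euler ds t0 lam0 dlam) => k Hk.
rewrite euler_conj//.
set E := expR _.
have -> : M.+1%:R * C ^+ 2 * (t ^+ M + 1) * E = C * (M.+1%:R * ((t ^+ M + 1) * E)) * C.
  by ring.
apply: opboundM.
- apply: mulr_ge0 => //; apply: mulr_ge0 => //; apply: mulr_ge0.
    by rewrite addr_ge0// exprn_ge0// ltW.
  exact: expR_ge0.
- apply: opboundM => //; exact: opbound_le PC (@opbound_specnorm _ _ _).
- exact: opbound_le QC (@opbound_specnorm _ _ _).
Qed.

Theorem corollary1 (R : realType) (M : nat) (hM : (1 <= M)%N)
    (D : R) (hD : 0 < D)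
    (h : 'I_M.+1 -> R) (h_le0 : forall i, h i <= 0)
    (h_first : h ord0 = 0) (h_last : h ord_max <> 0) :
  (exists B : R, forall (m : int) (t : R), 0 < t ->
     specnorm (mexp (t%:C *: Am D h m)) <= B) /\
  (forall (C0 lam0 : R), 0 < C0 -> 0 < lam0 ->
     (forall m : int, m <> 0 -> exists P J : 'M[R[i]]_M.+1,
        [/\ jordan_decomposition (Am D h m) P J,
            forall j, euclid (col j P) = 1,
            specnorm P <= C0
          & specnorm (invmx P) <= C0]) ->
     (forall (m : int) (z : R[i]), m <> 0 ->
        eigenvalue (Am D h m) z -> complex.Re z < - lam0) ->
     forall (m : int) (t : R), m <> 0 -> 0 < t ->
       specnorm (mexp (t%:C *: Am D h m))
         <= (M.+1%:R * C0 ^+ 2) * (t ^+ M + 1) * expR (- lam0 * t)).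
Proof.
split=> [|C0 lam0 _ lam0_gt0 jordanA eigA m t m0 t0].
  (* The bound 1 holds for every [m], zero included, since $tA_m$ is dissipative. *)
  exists 1 => m t t0; apply: specnorm_le; apply: opbound_mexp_dissipative => x.
  by rewrite -scalemxAl redotZ mulr_ge0_le0 ?redot_Am_le0// ltW.
have [P [J [PJ _ PC QC]]] := jordanA m m0.
by apply: specnorm_le; apply: opbound_mexp_jordan PJ _ _ PC QC _ => // z; exact: eigA.
Qed.
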